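(* Let $0<\beta<1$ and let $f\colon \mathbb{R}_{>0}\to\mathbb{R}_{\ge 0}$ be a non-decreasing function. Let $\mathcal{G}$ be a hereditary graph class such that, for every $n$-vertex graph $G\in\mathcal{G}$, there exists a $\beta$-balanced clique-based separator of $G$ of size $\mathcal{O}(f(n))$. Then every $n$-vertex graph $G\in\mathcal{G}$ has tree-independence number $\mathcal{O}(f(n)\cdot\log n)$. If in addition $f(n)=\Omega(n^{\varepsilon})$ for some $\varepsilon>0$ and there exists $c<1$ such that $f(\lfloor \beta n\rfloor)\le c f(n)$ for all sufficiently large $n$, then every $n$-vertex graph $G\in\mathcal{G}$ has tree-independence number $\mathcal{O}(f(n))$.
   Context: All graphs are finite, simple and have at least one vertex. A graph class is hereditary if it is closed under vertex deletion. A separation of a graph $G$ is a pair $(A,B)$ of subsets of $V(G)$ with $A\cup B=V(G)$ and no edge between $A\setminus B$ and $B\setminus A$; it is $\beta$-balanced if $\max\{|A\setminus B|,|B\setminus A|\}\le\beta|V(G)|$. Its separator is $A\cap B$. A $\beta$-balanced clique-based separator of $G$ is a collection $\mathcal{S}$ of pairwise vertex-disjoint cliques of $G$ whose union is the separator of a $\beta$-balanced separation of $G$; its size is $|\mathcal{S}|$. A tree decomposition of $G$ is a pair $(T,\{X_t\}_{t\in V(T)})$ with $T$ a tree and bags $X_t\subseteq V(G)$ such that every vertex of $G$ is in some bag, both endpoints of every edge lie in a common bag, and for each $u\in V(G)$ the nodes $t$ with $u\in X_t$ induce a connected subgraph of $T$. Its independence number is $\max_t\alpha(G[X_t])$, where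 $\alpha$ denotes the independence number of a graph. The tree-independence number of $G$ is the minimum independence number of a tree decomposition of $G$. Implicit constants in $\mathcal{O}(\cdot)$ are uniform over all graphs in the class: the hypothesis means there is a constant $C$ such that every graph in $\mathcal{G}$ with $n\ge 1$ vertices has such a separator of size at most $C f(n)$; the conclusions mean there is a constant $C'$ (independent of $G$ and $n$) such that the bound $C' f(n)\log n$, respectively $C' f(n)$, holds for all $G\in\mathcal{G}$ with $n\ge 2$ vertices. *)

(* Defs.v *)
From mathcomp Require Import all_boot all_order all_algebra.
From mathcomp Require Import boolp reals exp.

Set Implicit Arguments.
Unset Strict Implicit.
Unset Printing Implicit Defensive.

Import Order.TTheory GRing.Theory Num.Theory.

Record sgraph := SGraph {
  vertex :> finType;
  edge : rel vertex;
  edge_sym : symmetric edge;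
  edge_irr : irreflexive edge;
  vertex_gt0 : 0 < #|vertex| }.

Definition graph_iso (G H : sgraph) : Prop :=
  exists2 h : G -> H, bijective h & {mono h : x y / edge x y}.

Section DeleteVertex.
Variables (G : sgraph) (v : G).

Definition del_vertex_type := {x : G | x != v}.
Definition del_edge : rel del_vertex_type := fun x y => edge (val x) (val y).

Fact del_edge_sym : symmetric del_edge.
Proof. by move=> x y; apply: edge_sym. Qed.

Fact del_edge_irr : irreflexive del_edge.
Proof. by move=> x; apply: edge_irr. Qed.

(* Graphs are nonempty, so the deletion of v needs another vertex to remain. *)
Definition del_vertex (h : 0 < #|{: del_vertex_type}|) : sgraph :=
  SGraph del_edge_sym del_edge_irr h.
End DeleteVertex.

(* A graph class is a property of graphs up to isomorphism. *)
Definition iso_closed (C : sgraph -> Prop) : Prop :=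
  forall G H : sgraph, graph_iso G H -> C G -> C H.

Definition hereditary (C : sgraph -> Prop) : Prop :=
  forall (G : sgraph) (v : G) (h : 0 < #|{: del_vertex_type v}|),
    C G -> C (del_vertex h).

Definition clique (G : sgraph) (K : {set G}) : Prop :=
  {in K &, forall x y, x != y -> edge x y}.

Definition stable (G : sgraph) (S : {set G}) : bool :=
  [forall x in S, forall y in S, ~~ edge x y].

(* alpha(G[X]), taken inside G because an empty bag X induces no [sgraph]. *)
Definition indep_num (G : sgraph) (X : {set G}) : nat :=
  \max_(S : {set G} | (S \subset X) && stable S) #|S|.

Definition separation (G : sgraph) (A B : {set G}) : Prop :=
  A :|: B = [set: G] /\
  (forall x y, x \in A :\: B -> y \in B :\: A -> ~~ edge x y).

Definition balanced (R : realType) (beta : R) (G : sgraph) (A B : {set G}) :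
    Prop :=
  ((maxn #|A :\: B| #|B :\: A|)%:R <= beta * #|G|%:R)%R.

Definition clique_based_separator (R : realType) (beta : R) (G : sgraph)
    (S : {set {set G}}) : Prop :=
  [/\ forall K, K \in S -> clique K,
      trivIset S &
      exists A B : {set G},
        [/\ separation A B, balanced beta A B & cover S = A :&: B]].

(* G[X] is connected: paths are required to stay inside X. *)
Definition connected_in (G : sgraph) (X : {set G}) : Prop :=
  {in X &, forall x y,
    connect [rel u v | [&& u \in X, v \in X & edge u v]] x y}.

Definition acyclic (G : sgraph) : Prop :=
  forall c : seq G, 2 < size c -> ~ ucycle (@edge G) c.

Definition is_tree (T : sgraph) : Prop :=
  connected_in [set: T] /\ acyclic T.

Record tree_decomposition (G : sgraph) := TreeDecomposition {
  td_tree : sgraph;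
  td_bag : td_tree -> {set G};
  td_treeP : is_tree td_tree;
  td_vertexP : forall u : G, exists t, u \in td_bag t;
  td_edgeP : forall u v : G, edge u v ->
    exists t, u \in td_bag t /\ v \in td_bag t;
  td_connP : forall u : G, connected_in [set t | u \in td_bag t] }.

Definition td_indep (G : sgraph) (D : tree_decomposition G) : nat :=
  \max_(t : td_tree D) indep_num (td_bag t).

Section Trivial.
Fact unit_edge_sym : symmetric (fun _ _ : unit => false). Proof. by []. Qed.
Fact unit_edge_irr : irreflexive (fun _ : unit => fun _ : unit => false).
Proof. by []. Qed.
Fact unit_gt0 : 0 < #|{: unit}|. Proof. by rewrite card_unit. Qed.
Definition unit_graph := SGraph unit_edge_sym unit_edge_irr unit_gt0.

Fact unit_connected (X : {set unit_graph}) : connected_in X.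
Proof. by move=> [] [] _ _; apply: connect0. Qed.

Fact unit_tree : is_tree unit_graph.
Proof.
split; first exact: unit_connected.
by move=> [|[] [|[] c]] // _ /andP[].
Qed.

Fact tree_decomposition_exists (G : sgraph) :
  exists k, `[< exists D : tree_decomposition G, td_indep D = k >].
Proof.
have vP (u : G) : exists t : unit_graph, u \in [set: G] by exists tt.
have eP (u v : G) : edge u v ->
  exists t : unit_graph, u \in [set: G] /\ v \in [set: G] by exists tt.
pose D := @TreeDecomposition G unit_graph (fun=> setT) unit_tree vP eP
  (fun=> @unit_connected _).
by exists (td_indep D); apply/asboolP; exists D.
Qed.
End Trivial.

Definition tree_independence_number (G : sgraph) : nat :=
  ex_minn (tree_decomposition_exists G).

(* Main.v *)
(* For a balanced clique-based separator (A, B) of G, glue by an edge a tree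
   decomposition of G[A - B] to one of G[B - A] and add the separator to every
   bag: a stable set meets each clique at most once, so with t(n) the largest
   tree-independence number on n vertices, t(n) <= K f(n) + max t(m) over
   m <= beta n.  There are O(log n) levels, each costing at most K f(n); under
   the second hypothesis the costs decrease geometrically.
   Bounded n are absorbed in the constant because K f(1) >= 1. *)
Require Import Defs.
From mathcomp Require Import all_boot all_order all_algebra.
From mathcomp Require Import boolp reals exp.
From mathcomp Require Import lra.

Set Implicit Arguments.
Unset Strict Implicit.
Unset Printing Implicit Defensive.

Import Order.TTheory GRing.Theory Num.Theory.

(** * Induced subgraphs of a hereditary class *)

(** Vertices outside the image of [h] are deleted one at a time, by induction on the order of [G];
    once [h] is onto, it is an isomorphism. *)
Lemma hereditary_embedding (C : sgraph -> Prop) :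
  iso_closed C -> hereditary C ->
  forall (G H : sgraph) (h : H -> G),
    injective h -> {mono h : x y / edge x y} -> C G -> C H.
Proof.
move=> C_iso C_her G; have [n] := ubnP #|G|.
elim: n G => // n IHn G ltGn H h h_inj h_mono CG.
have [h_surj | /forallPn[v v_notin]] := boolP [forall v, v \in codom h].
  have [g hK gK] : bijective h.
    apply: (inj_card_bij h_inj); rewrite -(card_codom h_inj).
    by apply/subset_leq_card/subsetP=> v _; apply: (forallP h_surj).
  apply: C_iso CG; exists g; first by exists h.
  by move=> x y; rewrite -h_mono !gK.
have neq_v x : h x != v.
  by apply: contraNneq v_notin => <-; apply: codom_f.
pose h' x : del_vertex_type v := Sub (h x) (neq_v x).
have del_gt0 : 0 < #|{: del_vertex_type v}|.
  have /card_gt0P[x _] := vertex_gt0 H.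
  by apply/card_gt0P; exists (h' x).
apply: (IHn (del_vertex del_gt0) _ H h') => //.
- rewrite -ltnS; apply: leq_trans ltGn; rewrite ltnS card_sig.
  apply: proper_card; apply/properP; split; first exact/subsetP.
  by exists v; rewrite ?inE ?eqxx.
- by move=> x y /(congr1 val) /h_inj.
- exact: C_her.
Qed.

Section Induced.
Variables (G : sgraph) (X : {set G}).

Definition induced_edge : rel {x : G | x \in X} :=
  fun x y => edge (val x) (val y).

Fact induced_edge_sym : symmetric induced_edge.
Proof. by move=> x y; apply: edge_sym. Qed.

Fact induced_edge_irr : irreflexive induced_edge.
Proof. by move=> x; apply: edge_irr. Qed.

Definition induced (h : 0 < #|{: {x : G | x \in X}}|) : sgraph :=
  SGraph induced_edge_sym induced_edge_irr h.
End Induced.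

(** Pushes a separator of the induced subgraph forward along [val], so that the recursion can run on
    vertex subsets of one fixed graph. [X1] and [X2] are the images of [A :\: B] and [B :\: A]. *)
Lemma clique_based_separator_induced (R : realType) (beta : R) (G : sgraph)
    (X : {set G}) (h : 0 < #|{: {x : G | x \in X}}|)
    (S : {set {set induced h}}) :
  clique_based_separator beta S ->
  exists (S' : {set {set G}}) (X1 X2 : {set G}),
    [/\ forall K, K \in S' -> clique K, #|S'| <= #|S|,
        X = X1 :|: X2 :|: cover S', [disjoint X1 & X2]
      & forall x y, x \in X1 -> y \in X2 -> ~~ edge x y]
    /\ (#|X1|%:R <= beta * #|X|%:R /\ #|X2|%:R <= beta * #|X|%:R)%R.
Proof.
move=> [S_clique _ [A [B [[AB noedge] bal covS]]]].
pose v (Y : {set induced h}) : {set G} := [set val x | x in Y].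
have v_inj : injective (val : induced h -> G) by exact: val_inj.
have inv (x : induced h) Y : (val x \in v Y) = (x \in Y) by rewrite mem_imset.
have vE Y x : x \in v Y -> exists2 x' : induced h, x' \in Y & x = val x'.
  by move/imsetP=> [x' Yx' ->]; exists x'.
have cov : cover [set v K | K in S] = v (A :&: B).
  rewrite -covS; apply/setP=> x; apply/bigcupP/imsetP.
    move=> [_ /imsetP[K SK ->] /vE[x' Kx' ->]]; exists x' => //.
    by apply/bigcupP; exists K.
  by move=> [x' /bigcupP[K SK Kx'] ->]; exists (v K); rewrite ?imset_f ?inv.
have disj (Y Z : {set induced h}) : [disjoint Y & Z] -> [disjoint v Y & v Z].
  by rewrite -!setI_eq0 /v -imsetI ?imset_eq0 // => ? ? _ _; apply: val_inj.
have cX : #|induced h| = #|X| by rewrite card_sig.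
exists [set v K | K in S], (v (A :\: B)), (v (B :\: A)); rewrite cov; split.
  split.
  - move=> _ /imsetP[K /S_clique Kc ->] _ _ /vE[x Kx ->] /vE[y Ky ->] xy.
    by apply: Kc => //; apply: contraNneq xy => ->.
  - exact: leq_imset_card.
  - rewrite /v -!imsetU; have -> : A :\: B :|: B :\: A :|: A :&: B = setT.
      rewrite -AB; apply/setP=> x; rewrite !inE.
      by case: (x \in A); case: (x \in B).
    apply/setP=> x; apply/idP/imsetP => [Xx | [[x' Xx'] _ ->] //].
    by exists (Sub x Xx : induced h).
  - apply: disj; rewrite -setI_eq0; apply/eqP/setP=> x; rewrite !inE.
    by case: (x \in A); case: (x \in B).
  - by move=> _ _ /vE[x xA ->] /vE[y yB ->]; apply: noedge.
move: bal; rewrite /balanced cX !card_imset // => bal.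
by split; apply: le_trans bal; rewrite ler_nat ?leq_maxl ?leq_maxr.
Qed.

(** * Rooted trees and their gluing along an edge *)

Lemma connect_homo (T1 T2 : finType) (e1 : rel T1) (e2 : rel T2)
    (h : T1 -> T2) :
  {homo h : x y / e1 x y >-> e2 x y} ->
  {homo h : x y / connect e1 x y >-> connect e2 x y}.
Proof.
move=> h_homo x _ /connectP[p e1p ->]; elim: p x e1p => //= y p IHp x.
by move=> /andP[/h_homo xy /IHp]; apply: connect_trans; apply: connect1.
Qed.

(* Acyclicity in a form that survives gluing: ranking the vertices by distance
   to the root, each has at most one neighbour that is not farther away. *)
Definition rooted_at (T : sgraph) (r : T) (rk : T -> nat) : Prop :=
  (forall x y z, edge x y -> edge x z -> rk y <= rk x -> rk z <= rk x -> y = z)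
  /\ (forall y, edge r y -> rk r < rk y).

(* A vertex of maximal rank on a cycle would have two lower neighbours. *)
Lemma rooted_at_acyclic (T : sgraph) (r : T) (rk : T -> nat) :
  rooted_at r rk -> acyclic T.
Proof.
move=> [rk_uniq _] c c_gt2 /andP[c_cycle c_uniq].
case: c c_gt2 c_cycle c_uniq => // x0 c c_gt2 c_cycle c_uniq.
have [x cx x_max] := @arg_maxnP T x0 [in x0 :: c] rk (mem_head _ _).
have [i p rot_c] := rot_to cx.
have {c_cycle} : cycle (@edge T) (x :: p) by rewrite -rot_c rot_cycle.
have {c_uniq} : uniq (x :: p) by rewrite -rot_c rot_uniq.
have {c_gt2} : 2 < size (x :: p) by rewrite -rot_c size_rot.
have {rot_c cx} p_le y : y \in x :: p -> rk y <= rk x.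
  by rewrite -rot_c mem_rot => /x_max.
(* The neighbours of [x] on the cycle are its successor [y] and the last vertex [z], distinct
   because the cycle has length above 2. *)
case: p p_le => // y; case/lastP=> // p z p_le _ /and3P[_ yz _].
rewrite /= !rcons_path last_rcons => /andP[xy /andP[_ zx]].
case/negP: yz; rewrite mem_rcons inE; apply/orP; left; apply/eqP.
apply: (rk_uniq x); rewrite // 1?edge_sym // p_le //.
  by rewrite !inE eqxx orbT.
by rewrite !inE mem_rcons mem_head !orbT.
Qed.

Section JoinTrees.
Variables (T1 T2 : sgraph) (r1 : T1) (r2 : T2).

Definition join_edge : rel (T1 + T2) := fun x y =>
  match x, y with
  | inl a, inl b => edge a b
  | inr a, inr b => edge a b
  | inl a, inr b => (a == r1) && (b == r2)
  | inr b, inl a => (a == r1) && (b == r2)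
  end.

Fact join_edge_sym : symmetric join_edge.
Proof. by move=> [a|a] [b|b] //=; apply: edge_sym. Qed.

Fact join_edge_irr : irreflexive join_edge.
Proof. by move=> [a|a] /=; apply: edge_irr. Qed.

Fact join_gt0 : 0 < #|{: T1 + T2}|.
Proof. by rewrite card_sum addn_gt0 vertex_gt0. Qed.

Definition join : sgraph := SGraph join_edge_sym join_edge_irr join_gt0.

(** Ranks of the second tree are shifted above all ranks of the first, so [r2] hangs below [r1]. By
    the second clause of [rooted_at], [r2] has no lower neighbour in its own tree, so [r1] becomes
    its only one. *)
Lemma join_rooted rk1 rk2 : rooted_at r1 rk1 -> rooted_at r2 rk2 ->
  exists rk, rooted_at (inl r1 : join) rk.
Proof.
move=> [uniq1 root1] [uniq2 root2].
pose m := \max_x rk1 x.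
have rk1_lt a b : rk1 a < m + (rk2 b).+1.
  by rewrite addnS ltnS; apply: leq_trans (leq_addr _ _); apply: leq_bigmax.
exists (fun x : join =>
  match x with inl a => rk1 a | inr b => m + (rk2 b).+1 end).
split.
  move=> [a|a] [b|b] [c|c] //=; rewrite ?leq_add2l ?ltnS /join_edge.
  - by move=> ab ac /uniq1 h /h ->.
  - by move=> _ _ _; rewrite leqNgt rk1_lt.
  - by move=> _ _; rewrite leqNgt rk1_lt.
  - by move=> _ _; rewrite leqNgt rk1_lt.
  - by move=> /andP[/eqP-> _] /andP[/eqP-> _].
  - by move=> /andP[_ /eqP->] /root2 lt _; rewrite leqNgt lt.
  - by move=> + /andP[_ /eqP eqa]; rewrite eqa => /root2 lt; rewrite leqNgt lt.
  - by move=> ab ac /uniq2 h /h ->.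
by move=> [b|b] //= /root1.
Qed.

Lemma join_connected : connected_in [set: T1] -> connected_in [set: T2] ->
  connected_in [set: join].
Proof.
move=> conn1 conn2.
set e := [rel u v | [&& u \in [set: join], v \in [set: join] & edge u v]].
have e_sym : connect_sym e.
  by apply: sym_connect_sym => x y; rewrite /e /= !inE join_edge_sym.
suff to_r1 x : connect e x (inl r1).
  by move=> x y _ _; apply: connect_trans (to_r1 x) _; rewrite e_sym.
case: x => a.
  apply: (connect_homo _ (conn1 a r1 (in_setT _) (in_setT _))).
  by move=> x y /=; rewrite !inE.
apply: (@connect_trans _ _ (inr r2)).
  apply: (connect_homo _ (conn2 a r2 (in_setT _) (in_setT _))).
  by move=> x y /=; rewrite !inE.
by apply: connect1; rewrite /= !inE /= !eqxx.
Qed.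
End JoinTrees.

(** * Tree decompositions of induced subgraphs *)

Section SubsetDecompositions.
Variable G : sgraph.
Implicit Types X Y Z : {set G}.

Lemma indep_num_leq_card X : indep_num X <= #|X|.
Proof. by apply/bigmax_leqP=> S /andP[/subset_leq_card]. Qed.

Lemma stable_subset (S S' : {set G}) : S' \subset S -> stable S -> stable S'.
Proof.
move=> /subsetP sub /forall_inP st; apply/forall_inP=> x /sub/st/forall_inP xst.
by apply/forall_inP=> y /sub/xst.
Qed.

Lemma stable_clique_card (S K : {set G}) :
  stable S -> clique K -> #|S :&: K| <= 1.
Proof.
move=> /forall_inP st cl; apply/card_le1_eqP=> x y.
rewrite !inE => /andP[Sx Kx] /andP[Sy Ky]; apply/eqP; apply: contraT => xy.
by move/forall_inP: (st _ Sy) => /(_ _ Sx); rewrite edge_sym cl // eq_sym.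
Qed.

Lemma indep_num_setU_cover X (P : {set {set G}}) :
  (forall K, K \in P -> clique K) ->
  indep_num (X :|: cover P) <= indep_num X + #|P|.
Proof.
move=> cl; apply/bigmax_leqP=> S /andP[sub st].
(* The part of [S] outside [cover P] lies in [X]; the part inside is counted clique by clique. *)
rewrite -(cardsID (cover P) S) addnC leq_add //.
  apply: (@leq_bigmax_cond _ _ (fun S : {set G} => #|S|)).
  rewrite (stable_subset _ st) ?subsetDl // andbT.
  apply/subsetP=> x; rewrite inE => /andP[nx /(subsetP sub)].
  by rewrite inE (negPf nx) orbF.
rewrite /cover big_distrr /= -[leqRHS]sum1_card.
elim/big_ind2: _ => [|m A n B Am Bn|K PK]; first by rewrite cards0.
  by apply: leq_trans (leq_card_setU _ _) _; apply: leq_add.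
by apply: stable_clique_card => //; apply: cl.
Qed.

(** A tree decomposition of G[X] of independence number at most [k], kept inside [G] so that [X] may
    be empty. It carries a root and a rank, ready for gluing. *)
Definition decomposable X k : Prop :=
  exists (T : sgraph) (r : T) (rk : T -> nat) (bag : T -> {set G}),
  [/\ rooted_at r rk, connected_in [set: T],
      forall t, bag t \subset X /\ indep_num (bag t) <= k,
      forall u, connected_in [set t | u \in bag t]
    & (forall u, u \in X -> exists t, u \in bag t) /\
      {in X &, forall u v, edge u v -> exists t, u \in bag t /\ v \in bag t}].

Lemma decomposable_card X : decomposable X #|X|.
Proof.
exists unit_graph, tt, (fun=> 0), (fun=> X); split.
- by split.
- exact: unit_connected.
- by move=> _; split=> //; apply: indep_num_leq_card.
- by move=> u; apply: unit_connected.
by split=> [u Xu | u v Xu Xv _]; exists tt.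
Qed.

Lemma decomposable_setU X1 X2 (P : {set {set G}}) k1 k2 :
  [disjoint X1 & X2] ->
  (forall x y, x \in X1 -> y \in X2 -> ~~ edge x y) ->
  (forall K, K \in P -> clique K) ->
  decomposable X1 k1 -> decomposable X2 k2 ->
  decomposable (X1 :|: X2 :|: cover P) (maxn k1 k2 + #|P|).
Proof.
move=> dis12 noedge cl.
move=> [T1 [r1 [rk1 [bag1 [root1 conn1 sub1 uconn1 [vert1 edge1]]]]]].
move=> [T2 [r2 [rk2 [bag2 [root2 conn2 sub2 uconn2 [vert2 edge2]]]]]].
have [rk root] := join_rooted root1 root2.
have conn := @join_connected _ _ r1 r2 conn1 conn2.
pose bag (t : join r1 r2) := cover P :|:
  match t with inl a => bag1 a | inr b => bag2 b end.
have sub1' t : {subset bag1 t <= X1} by apply/subsetP; case: (sub1 t).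
have sub2' t : {subset bag2 t <= X2} by apply/subsetP; case: (sub2 t).
exists (join r1 r2), (inl r1), rk, bag; split=> //.
- move=> [a|b]; rewrite /bag; split.
  + rewrite setUC setSU //; apply: subset_trans (subsetUl _ _).
    by case: (sub1 a).
  + rewrite setUC; apply: leq_trans (indep_num_setU_cover _ cl) _.
    by rewrite leq_add2r leq_max; case: (sub1 a) => _ ->.
  + rewrite setUC setSU //; apply: subset_trans (subsetUr _ _).
    by case: (sub2 b).
  + rewrite setUC; apply: leq_trans (indep_num_setU_cover _ cl) _.
    by rewrite leq_add2r leq_max; case: (sub2 b) => _ ->; rewrite orbT.
(* A vertex of [cover P] lies in every bag. Any other occurs in one of the two trees only, as [X1]
   and [X2] are disjoint, and stays connected there. *)
- move=> u; have [uP | uP] := boolP (u \in cover P).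
    rewrite (_ : [set t | _] = setT) //.
    by apply/setP=> t; rewrite !inE uP.
  move=> [a|a] [b|b]; rewrite !inE (negPf uP) /= => ua ub.
  + have ua' : a \in [set t | u \in bag1 t] by rewrite inE.
    have ub' : b \in [set t | u \in bag1 t] by rewrite inE.
    apply: (connect_homo _ (uconn1 u a b ua' ub')).
    by move=> x y; rewrite /= !inE => /and3P[-> -> ->]; rewrite !orbT.
  + by case/negP: (disjointFr dis12 (sub1' _ _ ua)); apply: sub2' ub.
  + by case/negP: (disjointFr dis12 (sub1' _ _ ub)); apply: sub2' ua.
  + have ua' : a \in [set t | u \in bag2 t] by rewrite inE.
    have ub' : b \in [set t | u \in bag2 t] by rewrite inE.
    apply: (connect_homo _ (uconn2 u a b ua' ub')).
    by move=> x y; rewrite /= !inE => /and3P[-> -> ->]; rewrite !orbT.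
have vert u : u \in X1 :|: X2 :|: cover P -> exists t, u \in bag t.
  rewrite !inE -orbA => /or3P[/vert1[t ut] | /vert2[t ut] | uP].
  - by exists (inl t); rewrite !inE ut orbT.
  - by exists (inr t); rewrite !inE ut orbT.
  - by exists (inl r1); rewrite !inE uP.
split=> // u v uX vX uv.
(* An edge with an end in the separator is covered by any bag of its other end; every other edge
   stays on one side. *)
have [uP | uP] := boolP (u \in cover P).
  by have [t vt] := vert v vX; exists t; split=> //; rewrite !inE uP.
have [vP | vP] := boolP (v \in cover P).
  by have [t ut] := vert u uX; exists t; split=> //; rewrite !inE vP.
move: uX vX; rewrite !inE (negPf uP) (negPf vP) !orbF.
move=> /orP[u1|u2] /orP[v1|v2].
- have [t [ut vt]] := edge1 u v u1 v1 uv.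
  by exists (inl t); rewrite !inE ut vt !orbT.
- by case/negP: (noedge _ _ u1 v2).
- by case/negP: (noedge _ _ v1 u2); rewrite edge_sym.
- have [t [ut vt]] := edge2 u v u2 v2 uv.
  by exists (inr t); rewrite !inE ut vt !orbT.
Qed.

Lemma tree_independence_number_leq k :
  decomposable [set: G] k -> tree_independence_number G <= k.
Proof.
move=> [T [r [rk [bag [root conn bagk uconn [vert edg]]]]]].
have vertP u : exists t, u \in bag t by apply: vert.
have edgP u v : edge u v -> exists t, u \in bag t /\ v \in bag t.
  by apply: edg.
pose D := TreeDecomposition
  (conj conn (rooted_at_acyclic root)) vertP edgP uconn.
apply: (@leq_trans (td_indep D)); last first.
  by apply/bigmax_leqP=> t _; case: (bagk t).
rewrite /tree_independence_number; case: ex_minnP => n _; apply.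
by apply/asboolP; exists D.
Qed.
End SubsetDecompositions.

Local Open Scope ring_scope.

(** * The separator recursion *)

Section CliqueSeparatorRecursion.
Variables (R : realType) (beta K : R) (f : R -> R) (C : sgraph -> Prop).
Hypotheses (beta_gt0 : 0 < beta) (beta_lt1 : beta < 1).
Hypotheses (C_iso : iso_closed C) (C_her : hereditary C).
Hypothesis C_sep : forall G : sgraph, C G ->
  exists S : {set {set G}},
    clique_based_separator beta S /\ #|S|%:R <= K * f #|G|%:R.

Lemma subset_clique_separator (G : sgraph) (X : {set G}) :
  C G -> (0 < #|X|)%N ->
  exists (S : {set {set G}}) (X1 X2 : {set G}),
    [/\ forall Q, Q \in S -> clique Q, #|S|%:R <= K * f #|X|%:R,
        X = X1 :|: X2 :|: cover S, [disjoint X1 & X2]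
      & forall x y, x \in X1 -> y \in X2 -> ~~ edge x y]
    /\ (#|X1|%:R <= beta * #|X|%:R /\ #|X2|%:R <= beta * #|X|%:R).
Proof.
move=> CG X_gt0; have h : (0 < #|{: {x : G | x \in X}}|)%N by rewrite card_sig.
have CX : C (induced h).
  apply: (@hereditary_embedding _ C_iso C_her G (induced h) val) => //.
  exact: val_inj.
have [S [S_sep S_le]] := C_sep CX.
have [S' [X1 [X2 [[cl leS XE dis noedge] bal]]]] :=
  clique_based_separator_induced S_sep.
exists S', X1, X2; split=> //; split=> //.
apply: (@le_trans _ _ #|S|%:R); first by rewrite ler_nat.
by rewrite card_sig in S_le.
Qed.

(* A balanced separator of a one-vertex graph contains the vertex. *)
Lemma separator_bound_ge1 (G : sgraph) : C G -> 1 <= K * f 1.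
Proof.
move=> CG; have /card_gt0P[x _] := vertex_gt0 G.
have [|S [X1 [X2 [[_ + XE _ _] [le1 le2]]]]] :=
  @subset_clique_separator G [set x] CG; first by rewrite cards1.
move: le1 le2; rewrite cards1 !mulr1.
have small (Y : {set G}) : #|Y|%:R <= beta -> Y = set0.
  move=> /le_lt_trans /(_ beta_lt1).
  by rewrite (ltr_nat _ _ 1) ltnS leqn0 cards_eq0 => /eqP.
move=> /small X1E /small X2E; apply: le_trans; rewrite ler1n card_gt0.
apply/eqP=> S0; have : x \in [set x] by rewrite inE.
by rewrite XE X1E X2E S0 /cover big_set0 !setU0 inE.
Qed.

(** Any supersolution [g] of the recursion is a bound, so each conclusion of the theorem only needs
    a suitable [g]. The alternative [n <= g n] allows a single bag for small [n], and [g 0] accounts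
    for an empty side. The induction is on the size of subsets of [G]. *)
Lemma tree_independence_recursion (g : nat -> R) :
  0 <= g 0 ->
  (forall n : nat, (0 < n)%N -> n%:R <= g n \/
     forall m : nat, m%:R <= beta * n%:R -> K * f n%:R + g m <= g n) ->
  forall G : sgraph, C G -> (tree_independence_number G)%:R <= g #|G|.
Proof.
move=> g0 g_rec G CG.
suff dec (X : {set G}) : exists2 k, decomposable X k & k%:R <= g #|X|.
  have [k deck] := dec [set: G]; rewrite cardsT; apply: le_trans.
  by rewrite ler_nat; apply: tree_independence_number_leq.
have [n] := ubnP #|X|; elim: n X => // n IHn X ltXn.
have [X0 | X_gt0] := posnP #|X|.
  by exists #|X|; [apply: decomposable_card | rewrite X0].
have [leX | {}g_rec] := g_rec _ X_gt0.
  by exists #|X| => //; apply: decomposable_card.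
have [S [X1 [X2 [[cl leS XE dis noedge] [le1 le2]]]]] :=
  subset_clique_separator CG X_gt0.
have smaller (Y : {set G}) : #|Y|%:R <= beta * #|X|%:R -> (#|Y| < n)%N.
  move=> leY; apply: leq_trans (ltXn : (#|X| <= n)%N).
  by rewrite -(ltr_nat R); apply: le_lt_trans leY _; rewrite gtr_pMl // ltr0n.
have [k1 dec1 lek1] := IHn _ (smaller _ le1).
have [k2 dec2 lek2] := IHn _ (smaller _ le2).
exists (maxn k1 k2 + #|S|)%N.
  by rewrite {1}XE; apply: decomposable_setU.
rewrite natrD addrC; case: (leqP k1 k2) => _.
  by apply: le_trans (g_rec _ le2); apply: lerD.
by apply: le_trans (g_rec _ le1); apply: lerD.
Qed.
End CliqueSeparatorRecursion.

(** * Solving the recursion for the two bounds *)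

Theorem lemma1p1 (R : realType) (beta : R) (f : R -> R) (C : sgraph -> Prop)
  (beta_gt0 : 0 < beta) (beta_lt1 : beta < 1)
  (f_ge0 : forall x, 0 < x -> 0 <= f x)
  (f_mono : forall x y, 0 < x -> x <= y -> f x <= f y)
  (C_iso : iso_closed C) (C_her : hereditary C)
  (C_sep : exists K : R, forall G : sgraph, C G ->
     exists S : {set {set G}},
       clique_based_separator beta S /\ #|S|%:R <= K * f #|G|%:R) :
  (exists K : R, forall G : sgraph, C G -> (2 <= #|G|)%N ->
     (tree_independence_number G)%:R <= K * (f #|G|%:R * ln #|G|%:R)) /\
  ((exists2 eps : R, 0 < eps &
      exists2 k : R, 0 < k & exists N : nat, forall n : nat, (N <= n)%N ->
        k * n%:R `^ eps <= f n%:R) ->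
   (exists2 c : R, c < 1 & exists N : nat, forall n : nat, (N <= n)%N ->
      f (Num.floor (beta * n%:R))%:~R <= c * f n%:R) ->
   exists K : R, forall G : sgraph, C G -> (2 <= #|G|)%N ->
     (tree_independence_number G)%:R <= K * f #|G|%:R).
Proof.
case: C_sep => K sep.
have Kf1 := separator_bound_ge1 beta_lt1 C_iso C_her sep.
(* [1 <= K * f 1] and [0 <= f 1] force [K] to be positive as soon as the class contains a graph. *)
have K_gt0 (G : sgraph) : C G -> 0 < K.
  by move=> /Kf1; have := f_ge0 1 ltr01; nra.
have fn_mono m n : (0 < m)%N -> (m <= n)%N -> f m%:R <= f n%:R.
  by move=> m_gt0 le_mn; apply: f_mono; rewrite ?ltr0n ?ler_nat.
have fn_ge0 n : (0 < n)%N -> 0 <= f n%:R.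
  by move=> n_gt0; apply: f_ge0; rewrite ltr0n.
split.
  (* [ln n / L] is the logarithm of [n] to base 1/beta, which counts the levels of the recursion. *)
  pose L := - ln beta; have L_gt0 : 0 < L by rewrite oppr_gt0 ln_lt0 ?beta_gt0.
  have ln2 : 0 < ln 2 :> R by rewrite ln_gt0 ?ltr1n.
  (* For [n >= 2], [1 <= ln n / ln 2] absorbs the summand 1 of [1 + ln n / L]. *)
  exists (K * ((ln 2)^-1 + L^-1)) => G CG G_ge2.
  pose g n : R := if n is 0 then 0 else K * f n%:R * (1 + ln n%:R / L).
  have gS n : (0 < n)%N -> g n = K * f n%:R * (1 + ln n%:R / L) by case: n.
  have lnL_ge0 n : (0 < n)%N -> 0 <= ln n%:R / L.
    by move=> n_gt0; rewrite divr_ge0 ?ln_ge0 ?ler1n ?ltW.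
  have K0 := K_gt0 _ CG.
  have G_gt0 : (0 < #|G|)%N by apply: ltnW.
  apply: le_trans
    (tree_independence_recursion beta_lt1 C_iso C_her sep (g := g) _ _ CG) _.
  - by [].
  - move=> n n_gt0; right=> m le_m; rewrite (gS n n_gt0).
    have [-> /= | m_gt0] := posnP m.
      by rewrite addr0 ler_peMr ?lerDl ?lnL_ge0 ?mulr_ge0 ?fn_ge0 // ltW.
    have le_mn : (m <= n)%N.
      rewrite -(ler_nat R); apply: le_trans le_m _.
      by rewrite ger_pMl ?ltr0n // ltW.
    (* Passing from [n] to [m <= beta * n] lowers the logarithm by at least [L]; the unit gained
       pays for the separator cost [K * f n]. *)
    have ln_le : 1 + ln m%:R / L <= ln n%:R / L.
      have -> : 1 + ln m%:R / L = (L + ln m%:R) / L.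
        by rewrite mulrDl divff ?gt_eqF.
      rewrite ler_pM2r ?invr_gt0 // addrC lerBlDr -lnM ?posrE ?ltr0n // mulrC.
      by rewrite ler_ln ?posrE ?mulr_gt0 ?ltr0n.
    rewrite (gS m m_gt0) [leRHS]mulrDr mulr1 lerD2l -!mulrA ler_pM2l //.
    apply: ler_pM => //; [exact: fn_ge0 | | exact: fn_mono].
    by rewrite addr_ge0 ?lnL_ge0.
  - rewrite (gS _ G_gt0) -!mulrA ler_pM2l // mulrCA ler_wpM2l ?fn_ge0 //.
    rewrite mulrDl [L^-1 * _]mulrC lerD2r.
    by rewrite mulrC ler_pdivlMr // mul1r ler_ln ?posrE ?ltr0n // ler_nat.
move=> _ [c c_lt1 [N c_bound]].
(* [c] may be negative; with [d >= 0] also [K <= K / (1 - d)], used when [m = 0]. *)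
pose d := Num.max c 0.
have d_lt1 : 0 < 1 - d by rewrite subr_gt0 gt_max c_lt1 /=.
have d_ge0 : 0 <= d by rewrite le_max lexx orbT.
(* [K / (1 - d)] sums the geometric series of costs; [K * N] handles [n < N], where
   [n <= N * (K * f 1) <= K * N * f n]. *)
pose K' := K * N%:R + K / (1 - d).
exists K' => G CG G_ge2.
have K0 := K_gt0 _ CG.
have KN : 0 <= K * N%:R by rewrite mulr_ge0 ?ler0n ?ltW.
have KdE : K / (1 - d) * (1 - d) = K by rewrite divfK ?gt_eqF.
have Kd : 0 < K / (1 - d) by rewrite divr_gt0.
pose g n : R := if n is 0 then 0 else K' * f n%:R.
have gS n : (0 < n)%N -> g n = K' * f n%:R by case: n.
rewrite -gS; last exact: ltnW.
apply: (tree_independence_recursion beta_lt1 C_iso C_her sep) => // n n_gt0.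
rewrite (gS n n_gt0); have fn := fn_ge0 _ n_gt0.
have [le_Nn | lt_nN] := leqP N n; last first.
  left; apply: (@le_trans _ _ (N%:R * (K * f 1))).
    apply: (@le_trans _ _ N%:R); first by rewrite ler_nat ltnW.
    by rewrite ler_peMr ?ler0n ?(Kf1 _ CG).
  rewrite mulrA [N%:R * K]mulrC mulrDl.
  have := ler_wpM2l KN (fn_mono 1%N n isT n_gt0); have := mulr_ge0 (ltW Kd) fn.
  by lra.
right=> m le_m.
have [-> /= | m_gt0] := posnP m.
  rewrite addr0 ler_wpM2r // /K'; nra.
(* Being an integer, [m <= beta * n] is at most the floor of [beta * n], so monotonicity brings in
   the bound by [c]. *)
have f_le : f m%:R <= d * f n%:R.
  apply: (@le_trans _ _ (c * f n%:R)); last by rewrite ler_wpM2r // le_max lexx.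
  apply: le_trans (c_bound _ le_Nn); apply: f_mono; first by rewrite ltr0n.
  by rewrite -[m%:R]/(m%:Z%:~R) ler_int floor_ge_int.
rewrite (gS m m_gt0).
have K'0 : 0 <= K' by rewrite addr_ge0 // ltW.
have := ler_wpM2l K'0 f_le.
(* The fraction [1 - d] of [K' * f n] left free by [f m <= d * f n] covers the cost [K * f n]. *)
have : K * f n%:R <= K' * (1 - d) * f n%:R.
  by rewrite ler_wpM2r // mulrDl KdE lerDr mulr_ge0 // ltW.
by lra.
Qed.
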